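(* Let $k\geq 0$ be an integer. Every chordal graph $G$ with no $(k+2)$-clique has convex crossing number $$\mathrm{cr}^{\star}(G)\leq 16k^2\cdot\Delta(G)\cdot|V(G)|.$$
   Context: All graphs are undirected, simple and finite. $\Delta(G)$ denotes the maximum degree of $G$. A graph is chordal if every induced cycle is a triangle. A convex drawing of a graph represents the vertices by distinct points in the plane in convex position and each edge by the line-segment between its endpoints, such that the only vertices an edge intersects are its own endpoints, and no three edges intersect at a common point (except at a common endpoint). A crossing is a point of intersection between two edges other than a common endpoint. The convex crossing number $\mathrm{cr}^{\star}(G)$ is the minimum number of crossings in a convex drawing of $G$. *)

(* Defs.v *)
From HB Require Import structures.
From mathcomp Require Import all_boot all_order all_algebra.
From mathcomp Require Import mathcomp_extra boolp classical_sets functions.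
From mathcomp Require Import cardinality reals.

Set Implicit Arguments.
Unset Strict Implicit.
Unset Printing Implicit Defensive.

Import Order.TTheory GRing.Theory Num.Theory.

Local Open Scope ring_scope.

Record sgraph := SGraph {
  vertex :> finType;
  adj : rel vertex;
  adj_sym : symmetric adj;
  adj_irrefl : irreflexive adj
}.

Section Graphs.
Variable G : sgraph.
Implicit Types (A : {set G}) (s : seq G).

Definition max_degree : nat := (\max_(v : G) #|[pred w | adj v w]|)%N.

Definition is_clique A : Prop := {in A &, forall x y, x != y -> adj x y}.

(* [s] lists the vertices of a cycle in cyclic order, without repetition;
   inducedness says that every edge between its vertices is a cycle edge. *)
Definition induced_cycle s : Prop :=
  [/\ (3 <= size s)%N, uniq s, cycle (@adj G) s
    & {in s &, forall x y, adj x y -> y = next s x \/ x = next s y}].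

Definition chordal : Prop := forall s, induced_cycle s -> size s = 3%N.

(* Edges are unordered: an edge is the two-element set of its endpoints. *)
Definition is_edge A : Prop := exists x y : G, adj x y /\ A = [set x; y]%SET.

End Graphs.

Section ConvexDrawings.
Variables (R : realType) (G : sgraph).

Definition plane := 'rV[R]_2.

Implicit Types (p : G -> plane) (A : {set G}) (z : plane).

Definition segment (a b : plane) : set plane :=
  [set z | exists t : R, [/\ 0 <= t, t <= 1 & z = (1 - t) *: a + t *: b]].

Definition edge_segment p A : set plane :=
  [set z | exists x y : G, A = [set x; y]%SET /\ segment (p x) (p y) z].

(* No point is a convex combination of the others, i.e. every point is a
   vertex of the convex hull. *)
Definition convex_position p : Prop :=
  forall (v : G) (c : G -> R), (forall w, 0 <= c w) ->
    \sum_(w | w != v) c w = 1 -> p v <> \sum_(w | w != v) c w *: p w.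

Definition convex_drawing p : Prop :=
  [/\ injective p,
      convex_position p,
      (forall A v, is_edge A -> edge_segment p A (p v) -> v \in A)
    & (forall A B C z, is_edge A -> is_edge B -> is_edge C ->
         A <> B -> A <> C -> B <> C ->
         edge_segment p A z -> edge_segment p B z -> edge_segment p C z ->
         exists v, [/\ v \in A, v \in B, v \in C & z = p v])].

Definition crossing p : set plane :=
  [set z | exists A B, [/\ is_edge A, is_edge B & A <> B] /\
     [/\ edge_segment p A z, edge_segment p B z
       & ~ exists v, [/\ v \in A, v \in B & z = p v]]].

Definition has_convex_drawing_with (m : nat) : Prop :=
  exists p, convex_drawing p /\ (crossing p #= `I_m)%card.

Definition is_convex_crossing_number (m : nat) : Prop :=
  has_convex_drawing_with m /\
  forall m', has_convex_drawing_with m' -> (m <= m')%N.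

End ConvexDrawings.

(* Main.v *)
(* Removing simplicial vertices one at a time (Dirac) and reinserting each of
   them right after the last of its neighbours gives a linear order in which
   the earlier neighbours of every vertex form a clique, hence number at most
   [k], and in which [u < x < v < y] with edges [uv] and [xy] forces the edge
   [ux].  Draw the vertices in this order on a parabola: a crossing is then
   determined by the edge [xy] (at most [k n] choices), an earlier neighbour
   [u] of [x] (at most [k]) and a neighbour [v] of [u] (at most [Delta]), so
   there are at most [k^2 Delta n] crossings. *)
Require Import Defs.
From mathcomp Require Import boolp classical_sets cardinality.
From mathcomp Require Import all_boot all_order all_algebra zify ring lra.
From mathcomp Require Import reals.

Set Implicit Arguments.
Unset Strict Implicit.
Unset Printing Implicit Defensive.

Import Order.TTheory GRing.Theory Num.Theory.

(** * Shortest paths and their chords *)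

Lemma connect_shortest (T : finType) (e : rel T) (x y : T) :
  connect e x y -> exists p, [/\ path e x p, last x p = y, uniq (x :: p)
    & forall q, path e x q -> last x q = y -> size p <= size q].
Proof.
move=> /connectP[p0 p0P p0y].
pose P n := [exists t : n.-tuple T, path e x t && (last x t == y)].
have exP : exists n, P n.
  by exists (size p0); apply/existsP; exists (in_tuple p0); rewrite p0P -p0y /=.
have Pp q : path e x q -> last x q = y -> P (size q).
  by move=> qP qy; apply/existsP; exists (in_tuple q); rewrite qP qy /=.
have [n /existsP[t /andP[tP /eqP ty]] nmin] := ex_minnP exP.
case: (shortenP tP) ty => p pP pu psub py.
exists p; split=> // q qP qy; apply: leq_trans (nmin _ (Pp _ qP qy)).
by rewrite -(size_tuple t) uniq_leq_size //; case/andP: pu.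
Qed.

(** An edge from position [i] that skipped vertices of the path would bypass them and give a
    strictly shorter path with the same ends. *)
Lemma shortest_chordless (T : finType) (e : rel T) (x : T) (p : seq T) i j :
  path e x p ->
  (forall q, path e x q -> last x q = last x p -> size p <= size q) ->
  i < j <= size p -> e (nth x (x :: p) i) (nth x (x :: p) j) -> j = i.+1.
Proof.
move=> pP pmin /andP[ij js] eij; case: j => [//|j] in ij js eij *.
have ip : i <= size p by exact: leq_trans (ltnW ij) js.
have pE : last x (take i p) = nth x (x :: p) i.
  rewrite (last_nth x) size_takel //.
  by rewrite -[x :: take i p]/(take i.+1 (x :: p)) nth_take.
have := pmin (take i p ++ drop j p).
have dE : drop j p = nth x p j :: drop j.+1 p by rewrite -drop_nth.
have lE : last x (take i p ++ drop j p) = last x p.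
  by rewrite last_cat -[in RHS](cat_take_drop j p) last_cat dE.
have pt : path e x (take i p ++ drop j p).
  rewrite cat_path pE dE /= eij /=.
  move: (pP); rewrite -{1}(cat_take_drop i p) cat_path => /andP[-> _] /=.
  by move: pP; rewrite -{1}(cat_take_drop j p) cat_path dE /= => /and3P[].
move=> /(_ pt lE); rewrite size_cat size_takel // size_drop; lia.
Qed.

(** * Connectivity within a vertex subset *)

Definition adj_in (G : sgraph) (S : {set G}) : rel G :=
  fun u v => [&& adj u v, u \in S & v \in S].

Lemma adj_in_sym (G : sgraph) (S : {set G}) : symmetric (adj_in S).
Proof. by move=> u v; rewrite /adj_in adj_sym [(u \in S) && _]andbC. Qed.

Lemma adj_inW (G : sgraph) (S S' : {set G}) :
  S \subset S' -> subrel (connect (adj_in S)) (connect (adj_in S')).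
Proof.
move=> /subsetP SS'; apply: connect_sub => u v /= /and3P[uv /SS' uS /SS' vS].
by apply: connect1; rewrite /adj_in uv uS.
Qed.

Lemma path_adj_in (G : sgraph) (S : {set G}) u p :
  u \in S -> path (adj_in S) u p -> {subset u :: p <= S}.
Proof.
elim: p u => [|v p IH] u uS /= => [_ w|/andP[/and3P[_ _ vS] vp] w].
  by rewrite inE => /eqP->.
by rewrite inE => /predU1P[->//|]; exact: IH vp w.
Qed.

(** Every prefix of a path from [b] ends in the component of [b], so the whole path stays inside
    it. *)
Lemma connect_component (G : sgraph) (S : {set G}) b c :
  connect (adj_in S) b c ->
  connect (adj_in [set c' | connect (adj_in S) b c']) b c.
Proof.
case/connectP=> p; elim/last_ind: p c => [|p d IH] c; first by move=> _ ->.
rewrite rcons_path last_rcons => /andP[bp pd] ->.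
apply: connect_trans (IH _ bp erefl) (connect1 _).
have bl : connect (adj_in S) b (last b p) by apply/connectP; exists p.
rewrite /adj_in !inE bl (connect_trans bl (connect1 pd)) /=.
by case/and3P: pd => ->.
Qed.

(** The default [a] matters: for [i = size q] the index overflows and [nth] returns [a], the
    successor of the last vertex on the cycle. *)
Lemma next_nth_cons (T : eqType) (a : T) q i :
  uniq (a :: q) -> i <= size q ->
  next (a :: q) (nth a (a :: q) i) = nth a q i.
Proof. by move=> aq_uniq iq; rewrite next_nth mem_nth // index_uniq. Qed.

(** * Simplicial vertices of chordal graphs *)

Section Chordal.
Variables (G : sgraph) (chordalG : chordal G).

(* Otherwise a shortest path from [x] to [y] through [C], closed up by [a],
   would be an induced cycle of length at least four. *)
Lemma separator_adj (a x y : G) (C : {set G}) (c1 c2 : G) :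
  adj a x -> adj a y -> x != y ->
  {in C, forall c, (c != a) && ~~ adj a c} ->
  adj x c1 -> adj y c2 -> c1 \in C -> c2 \in C ->
  connect (adj_in C) c1 c2 -> adj x y.
Proof.
move=> ax ay xy aC xc1 yc2 c1C c2C c12; apply: contraT => nxy.
(* The path is confined to [Z], where [x] and [y] are the only neighbours of [a]. *)
pose Z := x |: (y |: C).
have CZ : C \subset Z by rewrite /Z setUA subsetUr.
have xZ : x \in Z by rewrite !inE eqxx.
have yZ : y \in Z by rewrite !inE eqxx orbT.
have aZ : a \notin Z.
  rewrite !inE; apply/negP => /or3P[/eqP E|/eqP E|/aC/andP[/eqP//]].
    by rewrite E adj_irrefl in ax.
  by rewrite E adj_irrefl in ay.
have Za w : w \in Z -> adj a w -> w = x \/ w = y.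
  rewrite !inE => /or3P[/eqP->|/eqP->|/aC/andP[_ /negPf->]] //; by [left|right].
have : connect (adj_in Z) x y.
  apply: connect_trans (connect1 (y := c1) _) _.
    by rewrite /adj_in xc1 xZ (subsetP CZ).
  apply: connect_trans (adj_inW CZ c12) (connect1 _).
  by rewrite /adj_in adj_sym yc2 yZ (subsetP CZ).
move=> /connect_shortest[p [pP py pu pmin]].
have sub := path_adj_in xZ pP.
have su : uniq (a :: x :: p) by rewrite cons_uniq pu andbT (contra (@sub a)).
have nextC i : i <= (size p).+1 ->
    next (a :: x :: p) (nth a (a :: x :: p) i) = nth a (x :: p) i.
  by move=> ip; rewrite next_nth_cons.
have nextx : next (a :: x :: p) a = x by rewrite (nextC 0).
have nexty : next (a :: x :: p) y = a.
  have -> : y = nth a (a :: x :: p) (size p).+1 by rewrite nth_last /= py.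
  by rewrite nextC //= nth_default.
(* An edge at [a] (index 0) ends in [x] or [y], its neighbours on the cycle; any other edge joins
   consecutive vertices of the shortest path. *)
have chords i j : i < j -> j < (size p).+2 ->
    adj (nth a (a :: x :: p) i) (nth a (a :: x :: p) j) ->
    nth a (a :: x :: p) j = next (a :: x :: p) (nth a (a :: x :: p) i) \/
    nth a (a :: x :: p) i = next (a :: x :: p) (nth a (a :: x :: p) j).
  case: j => // j; rewrite !ltnS => ij jp; case: i ij => [_|i ij].
    move=> aj; rewrite [nth a _ 0]/= in aj *.
    have [|->|->] := Za _ _ aj; first exact: (sub _ (@mem_nth _ a (x :: p) j jp)).
      by left; rewrite nextx.
    by right; rewrite nexty.
  have ip : i < size p by exact: leq_trans ij jp.
  have eqa l : l <= size p -> nth a (x :: p) l = nth x (x :: p) l.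
    by move=> lp; apply: set_nth_default; rewrite /= ltnS.
  move=> aij; left; rewrite (nextC i.+1) ?ltnS 1?ltnW //.
  suff -> : j = i.+1 by [].
  apply: (shortest_chordless pP); rewrite ?py ?ij //.
  have {}aij : adj (nth a (x :: p) i) (nth a (x :: p) j) by [].
  move: aij; rewrite (eqa i (ltnW ip)) (eqa j jp) /adj_in => ->.
  by rewrite !sub //; apply: mem_nth; rewrite /= ltnS // ltnW.
have /chordalG[] : induced_cycle (a :: x :: p).
  split=> //.
  - by case: (p) py => //= E; rewrite E eqxx in xy.
  - rewrite /= ax rcons_path py [adj y a]adj_sym ay andbT.
    by apply: sub_path pP => u v /and3P[].
  move=> u v /(nthP a)[i ip <-] /(nthP a)[j jp <-] uv.
  have [ij|ji|ij] := ltngtP i j; first exact: chords.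
    by rewrite adj_sym in uv; case: (chords j i ji ip uv); [right|left].
  by rewrite ij adj_irrefl in uv.
(* Length 3 leaves [p] with the single vertex [y], so the path is an edge from [x] to [y]. *)
case: (p) pP py => [|z []] //= /andP[/andP[xz _] _] E.
by rewrite -E xz in nxy.
Qed.

Definition simplicial_in (S : {set G}) (w : G) : Prop :=
  {in S &, forall x y, adj w x -> adj w y -> x != y -> adj x y}.

(* Induction on [S]: [w] is sought in the component [C] of [b] in [S] minus the
   closed neighbourhood of [a].  The neighbours [K] of [C] outside [C] form a
   clique, so the induction applies to [C :|: K], which misses [a]. *)
Lemma ex_simplicial_nonadj (S : {set G}) (a b : G) :
  a \in S -> b \in S -> b != a -> ~~ adj a b ->
  exists w, [/\ w \in S, w != a, ~~ adj a w & simplicial_in S w].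
Proof.
have [n] := ubnP #|S|; elim: n S a b => // n IH S a b leSn aS bS ba nab.
pose D := [set c in S | (c != a) && ~~ adj a c].
pose C := [set c | connect (adj_in D) b c].
have bD : b \in D by rewrite inE bS ba.
have CD c : c \in C -> c \in D.
  rewrite inE => /connectP[p pP ->]; exact: path_adj_in pP _ (mem_last _ _).
have DS c : c \in D -> c \in S by rewrite inE => /andP[].
have bC : b \in C by rewrite inE connect0.
have connC : {in C &, forall c c', connect (adj_in C) c c'}.
  move=> c c'; rewrite 2!inE => /connect_component bc /connect_component.
  by apply: connect_trans; rewrite sym_connect_sym //; exact: adj_in_sym.
pose K := [set x in S | (x \notin C) && [exists c in C, adj x c]].
have KP x : x \in K -> exists2 c, c \in C & adj x c.
  by rewrite inE => /and3P[_ _ /exists_inP].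
(* Otherwise [x] would lie in [D] and, having a neighbour in [C], in the component [C] itself. *)
have Ka x : x \in K -> adj a x.
  rewrite inE => /and3P[xS xC /exists_inP[c cC xc]]; apply: contraT => nax.
  have := CD c cC; rewrite inE => /and3P[cS ca nac].
  have xa : x != a by apply: contraNneq nac => <-.
  case/negP: xC; move: cC; rewrite !inE => /connect_trans; apply.
  by apply: connect1; rewrite /adj_in adj_sym xc !inE cS ca nac xS xa.
have Kclique : {in K &, forall x y, x != y -> adj x y}.
  move=> x y xK yK xy; have [[c1 c1C xc1] [c2 c2C yc2]] := (KP x xK, KP y yK).
  apply: (separator_adj (Ka x xK) (Ka y yK) xy _ xc1 yc2 c1C c2C).
    by move=> c /CD; rewrite inE => /and3P[_ -> ->].
  exact: connC.
pose S' := C :|: K.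
have S'S : S' \subset S.
  by apply/subsetP=> x; rewrite inE => /orP[/CD/DS|] //; rewrite inE => /andP[].
have aS' : a \notin S'.
  rewrite inE; apply/norP; split.
    by apply/negP => /CD; rewrite inE eqxx andbF.
  by apply/negP => /Ka; rewrite adj_irrefl.
have leS'n : #|S'| < n.
  rewrite ltnS in leSn; apply: leq_trans leSn; apply: proper_card.
  by rewrite properE S'S; apply/subsetPn; exists a.
(* All neighbours in [S] of a vertex of [C] lie in [C] or [K], and [C] avoids the closed
   neighbourhood of [a]. *)
have lift w : w \in C -> simplicial_in S' w ->
    exists w, [/\ w \in S, w != a, ~~ adj a w & simplicial_in S w].
  move=> wC wS'; exists w; have := CD w wC; rewrite inE => /and3P[-> -> ->].
  split=> // x y xS yS wx wy; apply: wS' => //; rewrite in_setU.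
    case xC: (x \in C) => //=; rewrite inE xS xC /=.
    by apply/exists_inP; exists w; rewrite // adj_sym.
  case yC: (y \in C) => //=; rewrite inE yS yC /=.
  by apply/exists_inP; exists w; rewrite // adj_sym.
pose full x := [forall y in S', (y != x) ==> adj x y].
have nfull x : ~~ full x -> exists2 y, y \in S' & (y != x) && ~~ adj x y.
  rewrite negb_forall_in => /exists_inP[y yS' nxy]; exists y => //.
  by rewrite -negb_imply.
(* A non-full vertex [c] of [S'] feeds the induction, giving [w] not adjacent to [c]. If [c] is in
   [K], then [w] is not, as [K] is a clique; once all of [K] is full, [w] cannot be in [K] either.
   So [w] is in [C]. *)
have [/forall_inP Kfull|] := boolP [forall x in K, full x]; last first.
  rewrite negb_forall_in => /exists_inP[c cK /nfull[y yS' /andP[yc ncy]]].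
  have cS' : c \in S' by rewrite inE cK orbT.
  have [w [wS' wc ncw sw]] := IH S' c y leS'n cS' yS' yc ncy.
  apply: (lift w) => //; move: wS'; rewrite inE => /orP[//|wK].
  by rewrite Kclique // eq_sym in ncw.
have [/forall_inP Cfull|] := boolP [forall x in C, full x]; last first.
  rewrite negb_forall_in => /exists_inP[c cC /nfull[y yS' /andP[yc ncy]]].
  have cS' : c \in S' by rewrite inE cC.
  have [w [wS' wc ncw sw]] := IH S' c y leS'n cS' yS' yc ncy.
  apply: (lift w) => //; move: wS'; rewrite inE => /orP[//|wK].
  have /forall_inP/(_ c cS') := Kfull w wK.
  by rewrite eq_sym wc adj_sym (negPf ncw).
(* Here [S'] is a clique, so [b] itself is simplicial in it. *)
apply: (lift b) => // x y xS' yS' _ _ xy.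
have /forall_inP/(_ y yS') : full x.
  by move: xS'; rewrite inE => /orP[/Cfull|/Kfull].
by rewrite eq_sym xy.
Qed.

Lemma ex_simplicial (S : {set G}) :
  S != set0 -> exists2 w, w \in S & simplicial_in S w.
Proof.
move=> /set0Pn[x xS].
have [/forall_inP cl|] :=
  boolP [forall u in S, forall v in S, (v != u) ==> adj u v].
  exists x => // u v uS vS _ _ uv.
  by have /forall_inP/(_ v vS) := cl u uS; rewrite eq_sym uv.
rewrite negb_forall_in => /exists_inP[a aS].
rewrite negb_forall_in => /exists_inP[b bS]; rewrite negb_imply => /andP[ba nab].
by have [w [wS _ _ sw]] := ex_simplicial_nonadj aS bS ba nab; exists w.
Qed.

End Chordal.

(** * The vertex order and the count of interleaving edges *)

Section Rank.
Variable G : sgraph.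

(* By the second condition, decreasing [r] is a perfect elimination order. *)
Definition nested_rank (S : {set G}) (r : G -> nat) : Prop :=
  [/\ {in S &, injective r},
      forall u x y, u \in S -> x \in S -> y \in S -> r u < r x < r y ->
        adj u y -> adj x y -> adj u x
    & forall u x v y, u \in S -> x \in S -> v \in S -> y \in S ->
        r u < r x -> r x < r v < r y -> adj u v -> adj x y -> adj u x].

(** No neighbour of [w] comes after it, so [w] can only be the right end of an edge. In the crossing
    condition its last neighbour [p] then takes its place: as [w] is simplicial, [p] is adjacent to
    all other neighbours of [w]. *)
Lemma nested_rank_insert (S : {set G}) (w : G) (r : G -> nat) :
  w \in S -> simplicial_in S w -> nested_rank (S :\ w) r ->
  exists r', nested_rank S r'.
Proof.
move=> wS sw [rinj rclique rcross].
have inS' z : z \in S -> z != w -> z \in S :\ w by move=> zS zw; rewrite !inE zw.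
have [q nbq lastnb] : exists2 q,
    forall z, z \in S -> z != w -> adj w z -> r z <= q
  & forall z, z \in S -> z != w -> adj w z ->
      exists p, [/\ p \in S, p != w, adj w p & r p = q].
  (* If [w] has no neighbour, the maximum is 0 and both properties hold vacuously. *)
  exists (\max_(z in S :\ w | adj w z) r z) => [z zS zw wz|z zS zw wz].
    by apply: (@leq_bigmax_cond _ _ r); rewrite inS'.
  have [|p /andP[pS' wp] qE] := @eq_bigmax_cond _ [pred z in S :\ w | adj w z] r.
    by apply/card_gt0P; exists z; rewrite inE inS'.
  by exists p; rewrite -qE; move: pS'; rewrite !inE => /andP[].
have [r' [r'inj r'lt r'wl r'wr]] : exists r' : G -> nat,
    [/\ {in S &, injective r'},
        forall z t, z != w -> t != w -> (r' z < r' t) = (r z < r t),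
        forall z, z != w -> (r' w < r' z) = (q < r z)
      & forall z, z != w -> (r' z < r' w) = (r z <= q)].
  (* Doubling the old ranks frees the odd values, and [w] takes the one just after rank [q]. *)
  exists (fun z => if z == w then q.*2.+1 else (r z).*2); split.
  - move=> x y xS yS; 
    case: eqVneq => [->|xw]; case: eqVneq => [->|yw] //.
    + by move/(congr1 odd); rewrite /= !odd_double.
    + by move/(congr1 odd); rewrite /= !odd_double.
    by move/double_inj/rinj; apply; exact: inS'.
  - by move=> z t /negPf-> /negPf->; rewrite ltn_double.
  - by move=> z /negPf->; rewrite eqxx -doubleS leq_double.
  by move=> z /negPf->; rewrite eqxx ltnS leq_double.
have ltr' z t : r' z < r' t -> z != t.
  by apply: contraTneq => ->; rewrite ltnn.
have ltr z t : z \in S -> t \in S -> z != w -> t != w -> z != t ->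
    r z <= r t -> r z < r t.
  move=> zS tS zw tw zt; rewrite leq_eqVlt => /predU1P[/rinj E|//].
  by rewrite E ?inS' ?eqxx in zt.
exists r'; split=> //.
  move=> u x y uS xS yS /andP[ux xy] uy xy'.
  have [E|yw] := eqVneq y w.
    by subst y; apply: sw; rewrite // 1?adj_sym ?ltr'.
  have [E|xw] := eqVneq x w.
    by subst x; move: xy; rewrite r'wl // ltnNge nbq.
  have [E|uw] := eqVneq u w.
    by subst u; move: (ltn_trans ux xy); rewrite r'wl // ltnNge nbq.
  move: ux xy; rewrite !r'lt // => ux xy.
  by apply: (rclique u x y); rewrite ?inS' ?ux.
move=> u x v y uS xS vS yS ux /andP[xv vy] uv xy.
have [E|yw] := eqVneq y w.
  subst y; have vw := ltr' _ _ vy; have xw := ltr' _ _ (ltn_trans xv vy).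
  have uw := ltr' _ _ (ltn_trans ux (ltn_trans xv vy)).
  rewrite adj_sym in xy; have [p [pS pw wp pq]] := lastnb x xS xw xy.
  have xv' := ltr' _ _ xv.
  move: ux xv vy; rewrite r'wr // !r'lt // => ux xv vp; rewrite -pq in vp.
  have xp : adj x p.
    by apply: sw => //; apply: contraTneq (leq_trans xv vp) => ->; rewrite ltnn.
  have [E|vp'] := eqVneq v p.
    by subst v; apply: (rclique u x p); rewrite ?inS' ?ux.
  by apply: (rcross u x v p); rewrite ?inS' // xv ltr.
have [E|xw] := eqVneq x w.
  by subst x; move: (ltn_trans xv vy); rewrite r'wl // ltnNge nbq.
have [E|vw] := eqVneq v w.
  subst v; have uw := ltr' _ _ (ltn_trans ux xv).
  rewrite adj_sym in uv; have [p [pS pw wp pq]] := lastnb u uS uw uv.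
  move: ux xv vy; rewrite r'wl // r'wr // r'lt // -pq => ux xp py.
  have up : adj u p.
    by apply: sw => //; apply: contraTneq (leq_trans ux xp) => ->; rewrite ltnn.
  have [<-//|xp'] := eqVneq p x.
  by apply: (rcross u x p y); rewrite ?inS' // ltr // eq_sym.
have [E|uw] := eqVneq u w.
  by subst u; move: (ltn_trans ux xv); rewrite r'wl // ltnNge nbq.
move: ux xv vy; rewrite !r'lt // => ux xv vy.
by apply: (rcross u x v y); rewrite ?inS' ?xv.
Qed.

Lemma chordal_nested_rank : chordal G -> exists r, nested_rank [set: G] r.
Proof.
move=> chordalG; move: [set: G] => S.
have [n] := ubnP #|S|; elim: n S => // n IH S leSn.
have [->|S0] := eqVneq S set0.
  by exists (fun=> 0); split=> [? ?|? ? ?|? ? ? ?]; rewrite inE.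
have [w wS sw] := ex_simplicial chordalG S0.
have [|r rP] := IH (S :\ w); first by rewrite (cardsD1 w S) wS in leSn.
exact: nested_rank_insert rP.
Qed.

(** The strict order fixes which edge comes first and which end is left, so each interleaving pair
    of edges is listed once. *)
Definition crossing_quads (r : G -> nat) : {set (G * G) * (G * G)} :=
  [set q | [&& adj q.1.1 q.1.2, adj q.2.1 q.2.2, r q.1.1 < r q.2.1,
            r q.2.1 < r q.1.2 & r q.1.2 < r q.2.2]].

Lemma clique_card_le (k : nat) (A : {set G}) :
  ~ (exists B : {set G}, is_clique B /\ #|B| = k + 2) ->
  is_clique A -> #|A| <= k.+1.
Proof.
move=> noclique Acl; rewrite leqNgt; apply/negP => /card_geqP[s [su sk sA]].
apply: noclique; exists [set x in s]; split; last first.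
  by rewrite cardsE (card_uniqP su) sk addn2.
by move=> x y; rewrite !inE => /sA xA /sA yA; exact: Acl.
Qed.

Lemma card_dep_prod_le (A B : finType) (P : pred A) (Q : A -> pred B) m n :
  #|P| <= m -> (forall a, #|Q a| <= n) ->
  #|[pred p : A * B | P p.1 && Q p.1 p.2]| <= m * n.
Proof.
move=> Pm Qn; rewrite -sum1_card -(pair_big_dep P Q (fun _ _ => 1)) /=.
apply: leq_trans (leq_mul Pm (leqnn n)); rewrite -sum_nat_const.
by apply: leq_sum => a _; rewrite sum1_card.
Qed.

Lemma card_crossing_quads (k : nat) (r : G -> nat) :
  ~ (exists B : {set G}, is_clique B /\ #|B| = k + 2) ->
  nested_rank [set: G] r ->
  #|crossing_quads r| <= k ^ 2 * max_degree G * #|G|.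
Proof.
move=> noclique [rinj rclique rcross].
(* Together with [x] its earlier neighbours form a clique, hence there are at most [k] of them. *)
pose back x := [pred u | adj u x && (r u < r x)].
have backk x : #|back x| <= k.
  have : #|x |: [set u | back x u]| <= k.+1.
    apply: (clique_card_le noclique) => u v; rewrite !inE.
    move=> /predU1P[->|/andP[ux rux]] /predU1P[->|/andP[vx rvx]]; rewrite ?eqxx //.
      by rewrite adj_sym.
    have [ruv _|rvu _|/rinj->] := ltngtP (r u) (r v); rewrite ?inE ?eqxx //.
      by apply: (rclique u v x); rewrite ?inE ?ruv.
    by rewrite adj_sym; apply: (rclique v u x); rewrite ?inE ?rvu.
  by rewrite cardsU1 !inE ltnn andbF cardsE.
(* Reordering to [(y, x, u, v)] lets each entry be chosen from the preceding ones: [x] in [back y],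
   [u] in [back x] by [rcross], and [v] adjacent to [u]. *)
pose f (q : (G * G) * (G * G)) := (q.2.2, q.2.1, q.1.1, q.1.2).
have finj : injective f by move=> [[? ?] [? ?]] [[? ?] [? ?]] [-> -> -> ->].
rewrite -(card_imset _ finj).
pose P1 := [pred p : G * G | predT p.1 && back p.1 p.2].
pose P2 := [pred p : G * G * G | P1 p.1 && back p.1.2 p.2].
pose P3 := [pred p : G * G * G * G | P2 p.1 && adj p.1.2 p.2].
have /leq_trans -> // : #|f @: crossing_quads r| <= #|P3|.
  apply/subset_leq_card/subsetP => _ /imsetP[[[u v] [x y]] + ->].
  rewrite !inE /= => /and5P[uv xy ux xv vy].
  by rewrite xy uv ux (ltn_trans xv vy) (rcross u x v y) ?inE ?xv.
rewrite (_ : k ^ 2 * _ * _ = #|G| * k * k * max_degree G); last first.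
  by rewrite mulnC mulnA expnS expn1 !mulnA.
have P1k : #|P1| <= #|G| * k.
  exact: (@card_dep_prod_le _ _ predT back).
have P2k : #|P2| <= #|G| * k * k.
  exact: (@card_dep_prod_le _ _ P1 (fun p => back p.2) _ _ P1k (fun p => backk p.2)).
apply: (@card_dep_prod_le _ _ P2 (fun p => [pred v | adj p.2 v]) _ _ P2k) => p.
exact: (leq_bigmax p.2).
Qed.
End Rank.

Local Open Scope ring_scope.

(** * Chords of the parabola *)

Section Parabola.
Variable R : realType.
Implicit Types (a b c d e x : R) (z : 'rV[R]_2).

Definition para x : 'rV[R]_2 := \row_(j < 2) x ^+ j.+1.

Lemma eq_rV2 z z' : z 0 0 = z' 0 0 -> z 0 1 = z' 0 1 -> z = z'.
Proof.
move=> z0 z1; apply/rowP => -[[|[|//]] i].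
  by rewrite (_ : Ordinal i = 0) //; apply: val_inj.
by rewrite (_ : Ordinal i = 1) //; apply: val_inj.
Qed.

Lemma para_inj : injective para.
Proof. by move=> a b /rowP/(_ 0); rewrite !mxE !expr1. Qed.

(** The line through the two points is written as an excess over the parabola, so chords meet
    exactly where these products agree. *)
Definition on_chord a b z : Prop :=
  [/\ a <= z 0 0, z 0 0 <= b & z 0 1 = z 0 0 ^+ 2 + (z 0 0 - a) * (b - z 0 0)].

Lemma segment_on_chord a b z :
  a < b -> segment (para a) (para b) z -> on_chord a b z.
Proof.
move=> ab [t [t0 t1 ->]]; rewrite /on_chord !mxE /= !expr1.
by split; [nra | nra | ring].
Qed.

Lemma segmentC (u v : plane R) z : segment u v z -> segment v u z.
Proof.
case=> t [t0 t1 ->]; exists (1 - t); split; [lra|lra|].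
by rewrite subKr addrC.
Qed.

Lemma on_chord_end a b z :
  on_chord a b z -> z 0 0 = a \/ z 0 0 = b -> z = para (z 0 0).
Proof.
move=> [_ _ E] ab; apply: eq_rV2; rewrite !mxE ?expr1 // E.
by case: ab => ->; ring.
Qed.

Lemma on_chord_para a b c : on_chord a b (para c) -> c = a \/ c = b.
Proof.
rewrite /on_chord !mxE /= expr1 => -[_ _ E].
have /eqP : (c - a) * (b - c) = 0 by lra.
by rewrite mulf_eq0 !subr_eq0 => /orP[/eqP|/eqP]; [left|right].
Qed.

(** Writing z for the abscissa, (z - a)(b - z) = (z - c)(d - z). If both sides are positive, z - a >
    z - c forces b - z < d - z. *)
Lemma on_chords_lt a b c d z : a < c -> on_chord a b z -> on_chord c d z ->
  (z 0 0 = b /\ (z 0 0 = c \/ z 0 0 = d)) \/ [/\ c < z 0 0, z 0 0 < b & b < d].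
Proof.
move=> ac [az zb E1] [cz zd]; rewrite E1 => /addrI E.
have [zb'|zb'] := eqVneq (z 0 0) b.
  left; split=> //; move: E; rewrite zb' subrr mulr0 => /esym/eqP.
  rewrite mulf_eq0 !subr_eq0 => /orP[/eqP->|/eqP->]; by [left|right].
have {zb zb'} zb : z 0 0 < b by rewrite lt_neqAle zb'.
have {}az : a < z 0 0 by lra.
have p0 : 0 < (z 0 0 - a) * (b - z 0 0) by rewrite mulr_gt0 ?subr_gt0.
have {cz} cz : c < z 0 0.
  rewrite lt_neqAle cz andbT; apply: contraTneq p0 => cz0.
  by rewrite E -cz0 subrr mul0r ltxx.
right; split=> //; nra.
Qed.

Lemma on_chords a b c d z : a < b -> c < d -> on_chord a b z -> on_chord c d z ->
  [\/ a = c /\ b = d,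
      (z 0 0 = a \/ z 0 0 = b) /\ (z 0 0 = c \/ z 0 0 = d),
      [/\ a < c, c < z 0 0, z 0 0 < b & b < d]
    | [/\ c < a, a < z 0 0, z 0 0 < d & d < b]].
Proof.
move=> ab cd abz cdz; have [ac|ca|ac] := ltgtP a c.
- have [[-> ?]|[? ? ?]] := on_chords_lt ac abz cdz.
    by apply: Or42; split=> //; right.
  by apply: Or43.
- have [[-> ?]|[? ? ?]] := on_chords_lt ca cdz abz.
    by apply: Or42; split=> //; right.
  by apply: Or44.
(* With a common left end the two excesses differ by (z - a)(b - d). *)
subst c; case: abz cdz => _ _ E [_ _]; rewrite E => /addrI/eqP.
rewrite -subr_eq0 -mulrBr mulf_eq0 => /orP[|].
  by rewrite subr_eq0 => /eqP za; apply: Or42; split; left.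
by move=> bd; apply: Or41; split=> //; lra.
Qed.

(* Three pairwise crossing chords have abscissae [a < c < e < b < d]; if these
   grow by factors of at least 3, then already the first two of them cannot
   meet to the right of [e]. *)
Lemma chords_not_concurrent a b c d e z :
  0 <= a -> 3 * a <= c -> 3 * c <= e -> 3 * b <= d -> e < z 0 0 -> z 0 0 < b ->
  on_chord a b z -> on_chord c d z -> False.
Proof.
move=> a0 ac ce bd ez zb [_ _ E1] [_ _]; rewrite E1 => /addrI E.
(* The growth gives z - a <= 2(z - c) and 2(b - z) < d - z, so (z - a)(b - z) < (z - c)(d - z),
   against [E]. *)
have h1 : 0 <= (z 0 0 - 2 * c + a) * (d - z 0 0) by apply: mulr_ge0; lra.
have h2 : 0 < (z 0 0 - a) * (d - 2 * b + z 0 0) by apply: mulr_gt0; lra.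
lra.
Qed.

End Parabola.

(** * The drawing on the parabola and its crossings *)

Section Drawing.
Variables (R : realType) (G : sgraph) (r : G -> nat).
Hypothesis rinj : injective r.
Implicit Types (u v x y : G) (A B C : {set G}).

(** Base 3 supplies the growth that rules out three concurrent edges. *)
Let t v : R := 3 ^+ r v.
Let p v : plane R := para (t v).

Lemma t_lt u v : (t u < t v) = (r u < r v)%N.
Proof. by rewrite /t ltr_eXn2l // ltr1n. Qed.

Lemma t_ge0 u : 0 <= t u.
Proof. exact: exprn_ge0. Qed.

Lemma t_ge3 u v : t u < t v -> 3 * t u <= t v.
Proof. by rewrite t_lt /t -exprS => uv; rewrite ler_weXn2l // ler1n. Qed.

Lemma t_inj : injective t.
Proof.
move=> u v E; apply: rinj.
by case: ltngtP (t_lt u v) (t_lt v u); rewrite // E ltxx.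
Qed.

Lemma p_inj : injective p.
Proof. by move=> u v /para_inj/t_inj. Qed.

(** A variance argument: matching both coordinates makes the weighted sum of [(t w - t v) ^+ 2]
    vanish, so all weights are 0 and cannot sum to 1. *)
Lemma p_convex : convex_position p.
Proof.
move=> v c c0 c1 /rowP pE.
have Et : \sum_(w | w != v) c w * t w = t v.
  have := pE 0; rewrite summxE mxE expr1 => ->.
  by apply: eq_bigr => w _; rewrite !mxE expr1.
have Et2 : \sum_(w | w != v) c w * t w ^+ 2 = t v ^+ 2.
  by have := pE 1; rewrite summxE mxE => ->; apply: eq_bigr => w _; rewrite !mxE.
have /eqP : \sum_(w | w != v) c w * (t w - t v) ^+ 2 = 0.
  transitivity (\sum_(w | w != v) c w * t w ^+ 2
     - 2 * t v * (\sum_(w | w != v) c w * t w)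
     + t v ^+ 2 * \sum_(w | w != v) c w).
    rewrite !mulr_sumr -sumrB -big_split /=; apply: eq_bigr => w _; ring.
  by rewrite Et Et2 c1; ring.
rewrite psumr_eq0 => [/allP c_eq0|w _]; last by rewrite mulr_ge0 ?sqr_ge0.
suff : \sum_(w | w != v) c w = 0 by rewrite c1; apply/eqP; rewrite oner_eq0.
apply: big1 => w wv; have := c_eq0 w (mem_index_enum w).
by rewrite wv /= mulf_eq0 sqrf_eq0 subr_eq0 (inj_eq t_inj) (negPf wv) orbF => /eqP.
Qed.

Lemma edge_on_chord A z : is_edge A -> edge_segment p A z -> exists a b,
  [/\ adj a b, A = [set a; b]%SET, t a < t b & on_chord (t a) (t b) z].
Proof.
move=> [x [y [xy AE]]] [a [b [AE' abz]]].
(* The pair naming the segment may differ in order from the pair witnessing the edge, but both list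
   the set [A]. *)
have {xy} ab : adj a b.
  have xE : x \in [set a; b]%SET by rewrite -AE' AE set21.
  have yE : y \in [set a; b]%SET by rewrite -AE' AE set22.
  case/set2P: xE xy => ->; case/set2P: yE => ->; rewrite ?adj_irrefl //.
  by rewrite adj_sym.
have [lt|gt|/t_inj E] := ltgtP (t a) (t b).
- by exists a, b; split=> //; apply: segment_on_chord.
- exists b, a; split=> //; first by rewrite adj_sym.
    by rewrite AE' finset.setUC.
  by apply: segment_on_chord => //; apply: segmentC.
by rewrite E adj_irrefl in ab.
Qed.

Lemma edge_vertex A v : is_edge A -> edge_segment p A (p v) -> v \in A.
Proof.
move=> eA /(edge_on_chord eA)[a [b [_ -> _ /on_chord_para[] /t_inj->]]].
  exact: set21.
exact: set22.
Qed.

Lemma edges_meet a b c d z :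
  t a < t b -> t c < t d -> on_chord (t a) (t b) z -> on_chord (t c) (t d) z ->
  [set a; b]%SET <> [set c; d]%SET ->
  [\/ exists v, [/\ v \in [set a; b]%SET, v \in [set c; d]%SET & z = p v],
      [/\ t a < t c, t c < z 0 0, z 0 0 < t b & t b < t d]
    | [/\ t c < t a, t a < z 0 0, z 0 0 < t d & t d < t b]].
Proof.
move=> ab cd abz cdz AB.
have [[/t_inj ac /t_inj bd]|[zab zcd]|?|?] := on_chords ab cd abz cdz.
- by case: AB; rewrite ac bd.
- apply: Or31; have zE := on_chord_end abz zab.
  have in2 x y : z 0 0 = t x \/ z 0 0 = t y ->
      exists2 v, v \in [set x; y]%SET & z = p v.
    by case=> E; [exists x|exists y]; rewrite ?set21 ?set22 // zE E.
  have [[v vA zv] [v' vB zv']] := (in2 _ _ zab, in2 _ _ zcd).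
  exists v; split=> //; suff -> : v = v' by [].
  by apply: p_inj; rewrite -zv.
- exact: Or32.
exact: Or33.
Qed.

Lemma p_drawing : convex_drawing p.
Proof.
split; [exact: p_inj|exact: p_convex|exact: edge_vertex|].
move=> A B C z eA eB eC AB AC BC zA zB zC.
have [a [a' [_ AE ltA chA]]] := edge_on_chord eA zA.
have [b [b' [_ BE ltB chB]]] := edge_on_chord eB zB.
have [c [c' [_ CE ltC chC]]] := edge_on_chord eC zC.
have inE D v : is_edge D -> edge_segment p D z -> z = p v -> v \in D.
  by move=> eD + zv; rewrite zv; exact: edge_vertex.
have common v : z = p v -> exists v, [/\ v \in A, v \in B, v \in C & z = p v].
  by move=> zv; exists v; split=> //; exact: inE zv.
rewrite AE BE in AB; rewrite AE CE in AC; rewrite BE CE in BC.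
have no3 x y u x' y' : t x < t y -> t y < t u -> t x' < t y' ->
    t u < z 0 0 -> z 0 0 < t x' ->
    on_chord (t x) (t x') z -> on_chord (t y) (t y') z -> False.
  move=> xy yu xy' uz zx'.
  by apply: chords_not_concurrent uz zx'; rewrite ?t_ge0 ?t_ge3.
(* Unless [z] is a vertex, the left ends are compared pairwise: the six linear orders fall to [no3]
   on the two leftmost chords, and the two cyclic patterns are impossible. *)
have [[v [_ _ /common//]]|[ab bz za' ab']|[ba az zb' ba']] :=
  edges_meet ltA ltB chA chB AB;
have [[v [_ _ /common//]]|[ac cz _ ac']|[ca _ zc' ca']] :=
  edges_meet ltA ltC chA chC AC;
have [[v [_ _ /common//]]|[bc _ _ bc']|[cb _ _ cb']] :=
  edges_meet ltB ltC chB chC BC; exfalso.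
- exact: (no3 a b c a' b').
- exact: (no3 a c b a' c').
- by move: (lt_trans ab bc); rewrite ltNge ltW.
- exact: (no3 c a b c' a').
- exact: (no3 b a c b' a').
- by move: (lt_trans ba ac); rewrite ltNge ltW.
- exact: (no3 b c a b' c').
- exact: (no3 c b a c' b').
Qed.

(* Abscissa of the meeting point of the chords of [y = x^2] over
   [t u, t v] and [t x, t y]. *)
Let meet (q : (G * G) * (G * G)) : plane R :=
  let: ((u, v), (x, y)) := q in
  let m := (t x * t y - t u * t v) / (t x + t y - t u - t v) in
  \row_(j < 2) (if j == 0 then m else (t u + t v) * m - t u * t v).

(** Edges meeting away from a common end interleave along the parabola; their slopes [t u + t v] and
    [t x + t y] then differ, so the quadruple determines the crossing point. *)
Lemma crossing_meet :
  (crossing p `<=` meet @` [set q | q \in crossing_quads r])%classic.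
Proof.
have meetE u v x y z : t u < t x -> t v < t y ->
    on_chord (t u) (t v) z -> on_chord (t x) (t y) z -> meet (u, v, (x, y)) = z.
  move=> ux vy [_ _ E1] [_ _ E2].
  have den0 : t x + t y - t u - t v != 0 by apply: lt0r_neq0; lra.
  have z0 : (t x * t y - t u * t v) / (t x + t y - t u - t v) = z 0 0.
    by apply: (mulIf den0); rewrite divfK //; lra.
  by apply: eq_rV2; rewrite !mxE /= z0 // E1; ring.
move=> z [A [B [[eA eB AB] [zA zB nv]]]].
have [a [b [ab AE ltab abz]]] := edge_on_chord eA zA.
have [c [d [cd BE ltcd cdz]]] := edge_on_chord eB zB.
rewrite AE BE in AB nv.
have [//|[ac cz zb bd]|[ca az zd db]] := edges_meet ltab ltcd abz cdz AB.
  exists ((a, b), (c, d)); last exact: meetE.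
  by rewrite /= inE /= ab cd -!t_lt ac bd (lt_trans cz).
exists ((c, d), (a, b)); last exact: meetE.
by rewrite /= inE /= ab cd -!t_lt ca db (lt_trans az).
Qed.

Lemma has_convex_drawing_le :
  exists2 m, has_convex_drawing_with R G m & (m <= #|crossing_quads r|)%N.
Proof.
have le_cross : (crossing p #<= `I_#|crossing_quads r|)%card.
  rewrite (card_le_eqr card_II).
  apply: card_le_trans (subset_card_le crossing_meet) _.
  apply: card_le_trans (card_image_le _ _) _.
  apply: card_le_trans (subset_card_le _) (card_image_le enum_val _).
  by move=> q qQ; exists (enum_rank_in qQ q) => //; rewrite enum_rankK_in.
have [m cross_m] : exists m, (crossing p #= `I_m)%card.
  by apply/finite_setP/finite_set_leP; exists #|crossing_quads r|.
exists m; first by exists p; split=> //; exact: p_drawing.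
by rewrite -card_le_II -(card_le_eql cross_m).
Qed.

End Drawing.

Theorem theorem21 (R : realType) (k : nat) (G : sgraph)
    (chordalG : chordal G)
    (no_cliqueG : ~ exists A : {set G}, is_clique A /\ #|A| = (k + 2)%N) :
  exists m : nat, is_convex_crossing_number R G m /\
    (m <= 16 * k ^ 2 * max_degree G * #|G|)%N.
Proof.
have [r rP] := chordal_nested_rank chordalG.
have rinj : injective r by case: rP => rinj _ _ x y; apply: rinj; rewrite inE.
have [m0 m0P m0le] := has_convex_drawing_le R rinj.
(* The crossing number is the least value of this predicate, made boolean so that a minimum can be
   taken; the drawing above shows that it is satisfiable. *)
have exm : exists m, `[< has_convex_drawing_with R G m >].
  by exists m0; apply/asboolP.
have [m /asboolP mP m_min] := ex_minnP exm.
have {}m_min m' : has_convex_drawing_with R G m' -> (m <= m')%N.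
  by move=> m'P; apply: m_min; apply/asboolP.
exists m; split=> //; apply: leq_trans (m_min _ m0P) _.
apply: leq_trans m0le _; apply: leq_trans (card_crossing_quads no_cliqueG rP) _.
by rewrite !leq_mul2r leq_pmull ?orbT.
Qed.
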